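(* Work in the type theory ILDTT (described in the context) equipped with $!$-types. Let $\Delta,x:A;\cdot\vdash B\;\mathrm{type}$ be a type in which $x$ does not occur free. Then: (1) if ILDTT also has $\Pi$-types and $\multimap$-types, the type $\Pi_{!x:!A}B$ is isomorphic (in context $\Delta$) to $!A\multimap B$; (2) if ILDTT also has $\Sigma$-types and $\otimes$-types, the type $\Sigma_{!x:!A}B$ is isomorphic (in context $\Delta$) to $!A\otimes B$.
   Context: ILDTT (intuitionistic linear dependent type theory) has judgements $\vdash\Delta;\Xi\;\mathrm{ctxt}$, $\Delta;\cdot\vdash A\;\mathrm{type}$, $\Delta;\Xi\vdash a:A$ and the corresponding judgemental equalities ($\equiv$). A context $\Delta;\Xi$ consists of an intuitionistic region $\Delta$ and a linear region $\Xi$; both may be extended by any type $A$ with $\Delta;\cdot\vdash A\;\mathrm{type}$, so types depend only on intuitionistic variables. Structural rules: $\Delta,x:A,\Delta';\cdot\vdash x:A$ (intuitionistic variables) and $\Delta;x:A\vdash x:A$ (linear variables, only with linear region exactly $x:A$); judgemental equality is an equivalence relation compatible with typing and all term/type formers; weakening and exchange for intuitionistic variables, exchange for linear variables (no weakening or contraction for them); substitution of $\Delta;\cdot\vdash a:A$ for an intuitionistic variable $x$ in types and terms; linear substitution: from $\Delta;\Xi,x:A\vdash b:B$ and $\Delta;\Xi'\vdash a:A$ infer $\Delta;\Xi,\Xi'\vdash b[a/x]:B$. Type formers (each with all commuting conversions of let/case constructs with linear program contexts): $!$: from $\Delta;\cdot\vdash A\;\mathrm{type}$ form $!A$; $\Delta;\cdot\vdash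 a:A$ gives $\Delta;\cdot\vdash !a:!A$; from $\Delta;\Xi\vdash t:!A$ and $\Delta,x:A;\Xi'\vdash b:B$ get $\Delta;\Xi,\Xi'\vdash \mathrm{let}\,t\,\mathrm{be}\,!x\,\mathrm{in}\,b:B$, with $\mathrm{let}\,!a\,\mathrm{be}\,!x\,\mathrm{in}\,b\equiv b[a/x]$ and $\mathrm{let}\,t\,\mathrm{be}\,!x\,\mathrm{in}\,!x\equiv t$. $\otimes$: $A\otimes B$ with $a\otimes b$ (contexts $\Xi,\Xi'$ joined) and $\mathrm{let}\,t\,\mathrm{be}\,x\otimes y\,\mathrm{in}\,c$ (from $\Delta;\Xi\vdash t:A\otimes B$, $\Delta;\Xi',x:A,y:B\vdash c:C$), with the usual $\beta$ and $\eta$ rules. $\multimap$: $A\multimap B$ with $\lambda_{x:A}b$ (from $\Delta;\Xi,x:A\vdash b:B$) and application $f(a)$ in context $\Xi,\Xi'$, with $\beta$ and $\eta$. $\Sigma$: from $\Delta,x:A;\cdot\vdash B\;\mathrm{type}$ form $\Sigma_{!x:!A}B$; from $\Delta;\cdot\vdash a:A$ and $\Delta;\Xi\vdash b:B[a/x]$ get $\Delta;\Xi\vdash !a\otimes b:\Sigma_{!x:!A}B$; from $\Delta;\cdot\vdash C\;\mathrm{type}$, $\Delta;\Xi\vdash t:\Sigma_{!x:!A}B$, $\Delta,x:A;\Xi',y:B\vdash c:C$ get $\Delta;\Xi,\Xi'\vdash\mathrm{let}\,t\,\mathrm{be}\,!x\otimes y\,\mathrm{in}\,c:C$; with $\mathrm{let}\,!a\otimes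 b\,\mathrm{be}\,!x\otimes y\,\mathrm{in}\,c\equiv c[a/x,b/y]$ and $\mathrm{let}\,t\,\mathrm{be}\,!x\otimes y\,\mathrm{in}\,!x\otimes y\equiv t$. $\Pi$: from $\Delta,x:A;\cdot\vdash B\;\mathrm{type}$ form $\Pi_{!x:!A}B$; from $\Delta,x:A;\Xi\vdash b:B$ get $\Delta;\Xi\vdash\lambda_{!x:!A}b:\Pi_{!x:!A}B$; from $\Delta;\cdot\vdash a:A$ and $\Delta;\Xi\vdash f:\Pi_{!x:!A}B$ get $\Delta;\Xi\vdash f(!a):B[a/x]$; with $(\lambda_{!x:!A}b)(!a)\equiv b[a/x]$ and $f\equiv\lambda_{!x:!A}f(!x)$. Two types $\Delta;\cdot\vdash A\;\mathrm{type}$, $\Delta;\cdot\vdash B\;\mathrm{type}$ are isomorphic if there are terms $\Delta;x:A\vdash f:B$ and $\Delta;y:B\vdash g:A$ with $\Delta;x:A\vdash g[f/y]\equiv x:A$ and $\Delta;y:B\vdash f[g/x]\equiv y:B$. *)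

(* Defs.v *)
(* ILDTT, intuitionistic linear dependent type theory, over an arbitrary
   signature of constants.  Raw syntax is de Bruijn with two independent index
   spaces, one for intuitionistic and one for linear variables.  Contexts are
   lists with the most recent variable at the head, so the extension
   "Δ, x:A" is [A :: Δ] and the concatenation "Ξ, Ξ'" is [Ξ' ++ Ξ]. *)

From mathcomp Require Import all_boot.
Set Implicit Arguments.
Unset Strict Implicit.
Unset Printing Implicit Defensive.

Record signature := Signature { tycon : Type; tmcon : Type }.

(* Types contain terms only as intuitionistic arguments of type constants, so
   the linear variables of a term never scope over the types inside it.
   In the comments x is a bound intuitionistic variable when it is written !x,
   and a bound linear variable otherwise. *)
Inductive ty (S : signature) : Type :=
| TCon of tycon S & seq (tm S)
| Bang of ty S                          (* !A *)
| Tensor of ty S & ty S                 (* A ⊗ B *)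
| Lolli of ty S & ty S                  (* A ⊸ B *)
| Sigma of ty S & ty S                  (* Σ_{!x:!A} B *)
| Pi of ty S & ty S                     (* Π_{!x:!A} B *)
with tm (S : signature) : Type :=
| IVar of nat
| LVar of nat
| Con of tmcon S & seq (tm S) & seq (tm S) (* intuitionistic, linear arguments *)
| BangI of tm S                         (* !a *)
| BangE of tm S & tm S                  (* let t be !x in b *)
| TensorI of tm S & tm S                (* a ⊗ b *)
| TensorE of tm S & tm S                (* let t be x ⊗ y in c; y has index 0 *)
| LolliI of ty S & tm S                 (* λ_{x:A} b *)
| LolliE of tm S & tm S                 (* f(a) *)
| SigmaI of tm S & tm S                 (* !a ⊗ b *)
| SigmaE of tm S & tm S                 (* let t be !x ⊗ y in c *)
| PiI of ty S & tm S                    (* λ_{!x:!A} b *)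
| PiE of tm S & tm S.                   (* f(!a) *)

Arguments IVar {S}.
Arguments LVar {S}.

Notation ictx S := (seq (ty S)).
Notation lctx S := (seq (ty S)).

(** Renaming *)

Definition up (r : nat -> nat) (n : nat) : nat :=
  if n is m.+1 then (r m).+1 else 0.

Fixpoint ren_ty {S} (ri : nat -> nat) (A : ty S) : ty S :=
  match A with
  | TCon c s => TCon c (map (ren_tm ri id) s)
  | Bang A => Bang (ren_ty ri A)
  | Tensor A B => Tensor (ren_ty ri A) (ren_ty ri B)
  | Lolli A B => Lolli (ren_ty ri A) (ren_ty ri B)
  | Sigma A B => Sigma (ren_ty ri A) (ren_ty (up ri) B)
  | Pi A B => Pi (ren_ty ri A) (ren_ty (up ri) B)
  end
with ren_tm {S} (ri rl : nat -> nat) (t : tm S) : tm S :=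
  match t with
  | IVar n => IVar (ri n)
  | LVar n => LVar (rl n)
  | Con c s s' => Con c (map (ren_tm ri rl) s) (map (ren_tm ri rl) s')
  | BangI a => BangI (ren_tm ri rl a)
  | BangE t b => BangE (ren_tm ri rl t) (ren_tm (up ri) rl b)
  | TensorI a b => TensorI (ren_tm ri rl a) (ren_tm ri rl b)
  | TensorE t c => TensorE (ren_tm ri rl t) (ren_tm ri (up (up rl)) c)
  | LolliI A b => LolliI (ren_ty ri A) (ren_tm ri (up rl) b)
  | LolliE f a => LolliE (ren_tm ri rl f) (ren_tm ri rl a)
  | SigmaI a b => SigmaI (ren_tm ri rl a) (ren_tm ri rl b)
  | SigmaE t c => SigmaE (ren_tm ri rl t) (ren_tm (up ri) (up rl) c)
  | PiI A b => PiI (ren_ty ri A) (ren_tm (up ri) rl b)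
  | PiE f a => PiE (ren_tm ri rl f) (ren_tm ri rl a)
  end.

Definition wk_ty {S} : ty S -> ty S := ren_ty succn.
Definition wk_tm {S} : tm S -> tm S := ren_tm succn id.
Definition lwk_tm {S} (k : nat) : tm S -> tm S := ren_tm id (addn k).

(** Simultaneous substitution *)

Definition scons {S} (a : tm S) (s : nat -> tm S) (n : nat) : tm S :=
  if n is m.+1 then s m else a.

Definition iup {S} (si : nat -> tm S) : nat -> tm S :=
  scons (IVar 0) (fun n => wk_tm (si n)).
Definition lup {S} (sl : nat -> tm S) : nat -> tm S :=
  scons (LVar 0) (fun n => lwk_tm 1 (sl n)).

Fixpoint subst_ty {S} (si : nat -> tm S) (A : ty S) : ty S :=
  match A with
  | TCon c s => TCon c (map (subst_tm si LVar) s)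
  | Bang A => Bang (subst_ty si A)
  | Tensor A B => Tensor (subst_ty si A) (subst_ty si B)
  | Lolli A B => Lolli (subst_ty si A) (subst_ty si B)
  | Sigma A B => Sigma (subst_ty si A) (subst_ty (iup si) B)
  | Pi A B => Pi (subst_ty si A) (subst_ty (iup si) B)
  end
with subst_tm {S} (si sl : nat -> tm S) (t : tm S) : tm S :=
  match t with
  | IVar n => si n
  | LVar n => sl n
  | Con c s s' => Con c (map (subst_tm si sl) s) (map (subst_tm si sl) s')
  | BangI a => BangI (subst_tm si sl a)
  | BangE t b =>
      BangE (subst_tm si sl t) (subst_tm (iup si) (fun n => wk_tm (sl n)) b)
  | TensorI a b => TensorI (subst_tm si sl a) (subst_tm si sl b)
  | TensorE t c =>
      TensorE (subst_tm si sl t)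
              (subst_tm (fun n => lwk_tm 2 (si n)) (lup (lup sl)) c)
  | LolliI A b =>
      LolliI (subst_ty si A) (subst_tm (fun n => lwk_tm 1 (si n)) (lup sl) b)
  | LolliE f a => LolliE (subst_tm si sl f) (subst_tm si sl a)
  | SigmaI a b => SigmaI (subst_tm si sl a) (subst_tm si sl b)
  | SigmaE t c =>
      SigmaE (subst_tm si sl t)
             (subst_tm (iup (fun n => lwk_tm 1 (si n)))
                       (lup (fun n => wk_tm (sl n))) c)
  | PiI A b =>
      PiI (subst_ty si A) (subst_tm (iup si) (fun n => wk_tm (sl n)) b)
  | PiE f a => PiE (subst_tm si sl f) (subst_tm si sl a)
  end.

(* B[a/x] and b[a/x] for the most recent intuitionistic variable x. *)
Definition inst_ty {S} (a : tm S) (B : ty S) : ty S :=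
  subst_ty (scons a IVar) B.
Definition inst_tm {S} (a b : tm S) : tm S :=
  subst_tm (scons a IVar) LVar b.

(* b[a/x] for the most recent linear variable x of b, where a lives in a linear
   region of length k: the result lives in that region appended to the rest of
   the linear region of b. *)
Definition linst {S} (k : nat) (a b : tm S) : tm S :=
  subst_tm IVar (scons a (fun n => LVar (k + n))) b.

(* Action on the part Δ' of an intuitionistic context Δ, Δ'. *)
Fixpoint ren_tel {S} (ri : nat -> nat) (Δ' : ictx S) : ictx S :=
  if Δ' is A :: Δ'' then ren_ty (iter (size Δ'') up ri) A :: ren_tel ri Δ''
  else [::].
Fixpoint subst_tel {S} (si : nat -> tm S) (Δ' : ictx S) : ictx S :=
  if Δ' is A :: Δ'' then
    subst_ty (iter (size Δ'') iup si) A :: subst_tel si Δ''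
  else [::].

(** Free intuitionistic variables *)

Fixpoint occurs_ty {S} (x : nat) (A : ty S) : bool :=
  match A with
  | TCon c s => has (occurs_tm x) s
  | Bang A => occurs_ty x A
  | Tensor A B | Lolli A B => occurs_ty x A || occurs_ty x B
  | Sigma A B | Pi A B => occurs_ty x A || occurs_ty x.+1 B
  end
with occurs_tm {S} (x : nat) (t : tm S) : bool :=
  match t with
  | IVar n => n == x
  | LVar n => false
  | Con c s s' => has (occurs_tm x) s || has (occurs_tm x) s'
  | BangI a => occurs_tm x a
  | BangE t b => occurs_tm x t || occurs_tm x.+1 b
  | TensorI a b => occurs_tm x a || occurs_tm x b
  | TensorE t c => occurs_tm x t || occurs_tm x c
  | LolliI A b => occurs_ty x A || occurs_tm x b
  | LolliE f a => occurs_tm x f || occurs_tm x a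
  | SigmaI a b => occurs_tm x a || occurs_tm x b
  | SigmaE t c => occurs_tm x t || occurs_tm x.+1 c
  | PiI A b => occurs_ty x A || occurs_tm x.+1 b
  | PiE f a => occurs_tm x f || occurs_tm x a
  end.

(* With named variables, a type over Δ, x:A in which x is not free is literally
   an expression over Δ; with de Bruijn indices the latter is obtained by
   lowering the free indices.  Only meaningful if index 0 is not free in B. *)
Definition unwk_ty {S} (B : ty S) : ty S := ren_ty predn B.

(** Theories *)

Inductive former := BangF | TensorF | LolliF | SigmaF | PiF.

(* The type formers that are present, the declared contexts and types of the
   constants, and arbitrary equational axioms. *)
Record theory (S : signature) := Theory {
  enabled : former -> bool;
  tycon_ctx : tycon S -> ictx S;
  tmcon_ictx : tmcon S -> ictx S;
  tmcon_lctx : tmcon S -> lctx S;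
  tmcon_ty : tmcon S -> ty S;
  ty_axiom : ictx S -> ty S -> ty S -> Prop;
  tm_axiom : ictx S -> lctx S -> tm S -> tm S -> ty S -> Prop
}.

(* The part of a judgement to the right of Δ; Ξ ⊢. *)
Inductive thesis (S : signature) : Type :=
| Ctxt
| IsType of ty S
| EqType of ty S & ty S
| HasType of tm S & ty S
| EqTerm of tm S & tm S & ty S.

Arguments Ctxt {S}.

Definition ren_thesis {S} (ri rl : nat -> nat) (J : thesis S) : thesis S :=
  match J with
  | Ctxt => Ctxt
  | IsType A => IsType (ren_ty ri A)
  | EqType A B => EqType (ren_ty ri A) (ren_ty ri B)
  | HasType a A => HasType (ren_tm ri rl a) (ren_ty ri A)
  | EqTerm a b A => EqTerm (ren_tm ri rl a) (ren_tm ri rl b) (ren_ty ri A)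
  end.

Definition subst_thesis {S} (si : nat -> tm S) (J : thesis S) : thesis S :=
  match J with
  | Ctxt => Ctxt
  | IsType A => IsType (subst_ty si A)
  | EqType A B => EqType (subst_ty si A) (subst_ty si B)
  | HasType a A => HasType (subst_tm si LVar a) (subst_ty si A)
  | EqTerm a b A =>
      EqTerm (subst_tm si LVar a) (subst_tm si LVar b) (subst_ty si A)
  end.

(* Exchange of the indices 0 and 1. *)
Definition swap01 (n : nat) : nat :=
  match n with 0 => 1 | 1 => 0 | _ => n end.

Reserved Notation "T ▷ Δ ;; Ξ ⊢ J"
  (at level 70, Δ at level 69, Ξ at level 69, J at level 69, no associativity).
Reserved Notation "T ▷ Δ ;; Ξ ≡ Δ' ;; Ξ'"
  (at level 70, Δ at level 69, Ξ at level 69, Δ' at level 69, Ξ' at level 69,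
   no associativity).

(* The usual presuppositions that would not be implied by the remaining premises
   of a rule are explicit: in particular, when the body of a let or of λ_{!x:!A}
   is typed over wk Ξ and wk C, the premises say that Ξ and C are well formed
   over Δ.

   The commuting conversions (the rules [comm_]...) use, as a linear program
   context C[-] with hole of type D, a term c with a distinguished linear
   variable of type D, and linear substitution for plugging.  Conversions with
   contexts that bind variables of the plugged term follow from these by the
   η rules. *)
Inductive derives (S : signature) (T : theory S) :
    ictx S -> lctx S -> thesis S -> Prop :=

(** Contexts *)
| ctxt_nil : T ▷ [::] ;; [::] ⊢ Ctxt
| ctxt_icons Δ Ξ A :
    T ▷ Δ ;; Ξ ⊢ Ctxt -> T ▷ Δ ;; [::] ⊢ IsType A ->
    T ▷ A :: Δ ;; map wk_ty Ξ ⊢ Ctxt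
| ctxt_lcons Δ Ξ A :
    T ▷ Δ ;; Ξ ⊢ Ctxt -> T ▷ Δ ;; [::] ⊢ IsType A ->
    T ▷ Δ ;; A :: Ξ ⊢ Ctxt

(** Variables *)
| ivar Δ Δ' A :
    T ▷ Δ' ++ A :: Δ ;; [::] ⊢ Ctxt ->
    T ▷ Δ' ++ A :: Δ ;; [::]
      ⊢ HasType (IVar (size Δ')) (ren_ty (addn (size Δ').+1) A)
| lvar Δ A :
    T ▷ Δ ;; [:: A] ⊢ Ctxt ->
    T ▷ Δ ;; [:: A] ⊢ HasType (LVar 0) A

(** Constants and axioms; instances arise by substitution *)
| tycon_form c (Δ := tycon_ctx T c) :
    T ▷ Δ ;; [::] ⊢ Ctxt ->
    T ▷ Δ ;; [::] ⊢ IsType (TCon c (mkseq IVar (size Δ)))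
| tmcon_intro c (Δ := tmcon_ictx T c) (Ξ := tmcon_lctx T c) :
    T ▷ Δ ;; Ξ ⊢ Ctxt -> T ▷ Δ ;; [::] ⊢ IsType (tmcon_ty T c) ->
    T ▷ Δ ;; Ξ
      ⊢ HasType (Con c (mkseq IVar (size Δ)) (mkseq LVar (size Ξ)))
                (tmcon_ty T c)
| ty_axiom_eq Δ A B :
    ty_axiom T Δ A B ->
    T ▷ Δ ;; [::] ⊢ IsType A -> T ▷ Δ ;; [::] ⊢ IsType B ->
    T ▷ Δ ;; [::] ⊢ EqType A B
| tm_axiom_eq Δ Ξ a b A :
    tm_axiom T Δ Ξ a b A ->
    T ▷ Δ ;; Ξ ⊢ HasType a A -> T ▷ Δ ;; Ξ ⊢ HasType b A ->
    T ▷ Δ ;; Ξ ⊢ EqTerm a b A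

(** Judgemental equality *)
| eqty_refl Δ A :
    T ▷ Δ ;; [::] ⊢ IsType A -> T ▷ Δ ;; [::] ⊢ EqType A A
| eqty_sym Δ A B :
    T ▷ Δ ;; [::] ⊢ EqType A B -> T ▷ Δ ;; [::] ⊢ EqType B A
| eqty_trans Δ A B C :
    T ▷ Δ ;; [::] ⊢ EqType A B -> T ▷ Δ ;; [::] ⊢ EqType B C ->
    T ▷ Δ ;; [::] ⊢ EqType A C
| eqtm_refl Δ Ξ a A :
    T ▷ Δ ;; Ξ ⊢ HasType a A -> T ▷ Δ ;; Ξ ⊢ EqTerm a a A
| eqtm_sym Δ Ξ a b A :
    T ▷ Δ ;; Ξ ⊢ EqTerm a b A -> T ▷ Δ ;; Ξ ⊢ EqTerm b a A
| eqtm_trans Δ Ξ a b c A :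
    T ▷ Δ ;; Ξ ⊢ EqTerm a b A -> T ▷ Δ ;; Ξ ⊢ EqTerm b c A ->
    T ▷ Δ ;; Ξ ⊢ EqTerm a c A
| conv_ctxt Δ Ξ Δ' Ξ' J :
    T ▷ Δ ;; Ξ ⊢ J -> T ▷ Δ ;; Ξ ≡ Δ' ;; Ξ' -> T ▷ Δ' ;; Ξ' ⊢ J
| conv_tm Δ Ξ a A B :
    T ▷ Δ ;; Ξ ⊢ HasType a A -> T ▷ Δ ;; [::] ⊢ EqType A B ->
    T ▷ Δ ;; Ξ ⊢ HasType a B
| conv_eqtm Δ Ξ a b A B :
    T ▷ Δ ;; Ξ ⊢ EqTerm a b A -> T ▷ Δ ;; [::] ⊢ EqType A B ->
    T ▷ Δ ;; Ξ ⊢ EqTerm a b B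

(** Structural rules *)
| iweak Δ Δ' Ξ A J (ri := iter (size Δ') up succn) :
    T ▷ Δ' ++ Δ ;; Ξ ⊢ J -> T ▷ Δ ;; [::] ⊢ IsType A ->
    T ▷ ren_tel succn Δ' ++ A :: Δ ;; map (ren_ty ri) Ξ ⊢ ren_thesis ri id J
| iexch Δ Δ' Ξ A B J (ri := iter (size Δ') up swap01) :
    T ▷ Δ' ++ wk_ty B :: A :: Δ ;; Ξ ⊢ J -> T ▷ Δ ;; [::] ⊢ IsType B ->
    T ▷ ren_tel swap01 Δ' ++ wk_ty A :: B :: Δ ;; map (ren_ty ri) Ξ
      ⊢ ren_thesis ri id J
| lexch Δ Ξ Ξ' A B J :
    T ▷ Δ ;; Ξ' ++ A :: B :: Ξ ⊢ J ->
    T ▷ Δ ;; Ξ' ++ B :: A :: Ξ ⊢ ren_thesis id (iter (size Ξ') up swap01) J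
| isubst Δ Δ' Ξ a A J (si := iter (size Δ') iup (scons a IVar)) :
    T ▷ Δ' ++ A :: Δ ;; Ξ ⊢ J -> T ▷ Δ ;; [::] ⊢ HasType a A ->
    T ▷ subst_tel (scons a IVar) Δ' ++ Δ ;; map (subst_ty si) Ξ
      ⊢ subst_thesis si J
| isubst_eqty Δ Δ' a a' A B B'
    (si := iter (size Δ') iup (scons a IVar))
    (si' := iter (size Δ') iup (scons a' IVar)) :
    T ▷ Δ' ++ A :: Δ ;; [::] ⊢ EqType B B' ->
    T ▷ Δ ;; [::] ⊢ HasType a A -> T ▷ Δ ;; [::] ⊢ EqTerm a a' A ->
    T ▷ subst_tel (scons a IVar) Δ' ++ Δ ;; [::]
      ⊢ EqType (subst_ty si B) (subst_ty si' B')
| isubst_eqtm Δ Δ' Ξ a a' A b b' B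
    (si := iter (size Δ') iup (scons a IVar))
    (si' := iter (size Δ') iup (scons a' IVar)) :
    T ▷ Δ' ++ A :: Δ ;; Ξ ⊢ EqTerm b b' B ->
    T ▷ Δ ;; [::] ⊢ HasType a A -> T ▷ Δ ;; [::] ⊢ EqTerm a a' A ->
    T ▷ subst_tel (scons a IVar) Δ' ++ Δ ;; map (subst_ty si) Ξ
      ⊢ EqTerm (subst_tm si LVar b) (subst_tm si' LVar b') (subst_ty si B)
| lsubst Δ Ξ Ξ' a A b B :
    T ▷ Δ ;; A :: Ξ ⊢ HasType b B -> T ▷ Δ ;; Ξ' ⊢ HasType a A ->
    T ▷ Δ ;; Ξ' ++ Ξ ⊢ HasType (linst (size Ξ') a b) B
| lsubst_eqtm Δ Ξ Ξ' a a' A b b' B :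
    T ▷ Δ ;; A :: Ξ ⊢ EqTerm b b' B -> T ▷ Δ ;; Ξ' ⊢ EqTerm a a' A ->
    T ▷ Δ ;; Ξ' ++ Ξ ⊢ EqTerm (linst (size Ξ') a b) (linst (size Ξ') a' b') B

(** ! *)
| bang_form Δ A :
    enabled T BangF ->
    T ▷ Δ ;; [::] ⊢ IsType A -> T ▷ Δ ;; [::] ⊢ IsType (Bang A)
| bang_form_eq Δ A A' :
    enabled T BangF ->
    T ▷ Δ ;; [::] ⊢ EqType A A' -> T ▷ Δ ;; [::] ⊢ EqType (Bang A) (Bang A')
| bang_intro Δ a A :
    enabled T BangF ->
    T ▷ Δ ;; [::] ⊢ HasType a A ->
    T ▷ Δ ;; [::] ⊢ HasType (BangI a) (Bang A)
| bang_intro_eq Δ a a' A :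
    enabled T BangF ->
    T ▷ Δ ;; [::] ⊢ EqTerm a a' A ->
    T ▷ Δ ;; [::] ⊢ EqTerm (BangI a) (BangI a') (Bang A)
| bang_elim Δ Ξ Ξ' t A b B :
    enabled T BangF ->
    T ▷ Δ ;; Ξ' ⊢ Ctxt -> T ▷ Δ ;; [::] ⊢ IsType B ->
    T ▷ Δ ;; Ξ ⊢ HasType t (Bang A) ->
    T ▷ A :: Δ ;; map wk_ty Ξ' ⊢ HasType b (wk_ty B) ->
    T ▷ Δ ;; Ξ' ++ Ξ ⊢ HasType (BangE (lwk_tm (size Ξ') t) b) B
| bang_elim_eq Δ Ξ Ξ' t t' A b b' B :
    enabled T BangF ->
    T ▷ Δ ;; Ξ' ⊢ Ctxt -> T ▷ Δ ;; [::] ⊢ IsType B ->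
    T ▷ Δ ;; Ξ ⊢ EqTerm t t' (Bang A) ->
    T ▷ A :: Δ ;; map wk_ty Ξ' ⊢ EqTerm b b' (wk_ty B) ->
    T ▷ Δ ;; Ξ' ++ Ξ
      ⊢ EqTerm (BangE (lwk_tm (size Ξ') t) b) (BangE (lwk_tm (size Ξ') t') b') B
| bang_beta Δ Ξ' a A b B :
    enabled T BangF ->
    T ▷ Δ ;; Ξ' ⊢ Ctxt -> T ▷ Δ ;; [::] ⊢ IsType B ->
    T ▷ Δ ;; [::] ⊢ HasType a A ->
    T ▷ A :: Δ ;; map wk_ty Ξ' ⊢ HasType b (wk_ty B) ->
    T ▷ Δ ;; Ξ'
      ⊢ EqTerm (BangE (lwk_tm (size Ξ') (BangI a)) b) (inst_tm a b) B
| bang_eta Δ Ξ t A :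
    enabled T BangF ->
    T ▷ Δ ;; Ξ ⊢ HasType t (Bang A) ->
    T ▷ Δ ;; Ξ ⊢ EqTerm (BangE t (BangI (IVar 0))) t (Bang A)
| comm_bang Δ Ξ Ξ' Ξ'' t A b D c C
    (k := size (Ξ' ++ Ξ)) (t' := lwk_tm (size Ξ') t) :
    enabled T BangF ->
    T ▷ Δ ;; Ξ' ⊢ Ctxt -> T ▷ Δ ;; [::] ⊢ IsType D ->
    T ▷ Δ ;; Ξ ⊢ HasType t (Bang A) ->
    T ▷ A :: Δ ;; map wk_ty Ξ' ⊢ HasType b (wk_ty D) ->
    T ▷ Δ ;; D :: Ξ'' ⊢ HasType c C ->
    T ▷ Δ ;; (Ξ' ++ Ξ) ++ Ξ''
      ⊢ EqTerm (BangE t' (linst k b (wk_tm c))) (linst k (BangE t' b) c) C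

(** ⊗ *)
| tensor_form Δ A B :
    enabled T TensorF ->
    T ▷ Δ ;; [::] ⊢ IsType A -> T ▷ Δ ;; [::] ⊢ IsType B ->
    T ▷ Δ ;; [::] ⊢ IsType (Tensor A B)
| tensor_form_eq Δ A A' B B' :
    enabled T TensorF ->
    T ▷ Δ ;; [::] ⊢ EqType A A' -> T ▷ Δ ;; [::] ⊢ EqType B B' ->
    T ▷ Δ ;; [::] ⊢ EqType (Tensor A B) (Tensor A' B')
| tensor_intro Δ Ξ Ξ' a A b B :
    enabled T TensorF ->
    T ▷ Δ ;; Ξ ⊢ HasType a A -> T ▷ Δ ;; Ξ' ⊢ HasType b B ->
    T ▷ Δ ;; Ξ' ++ Ξ ⊢ HasType (TensorI (lwk_tm (size Ξ') a) b) (Tensor A B)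
| tensor_intro_eq Δ Ξ Ξ' a a' A b b' B :
    enabled T TensorF ->
    T ▷ Δ ;; Ξ ⊢ EqTerm a a' A -> T ▷ Δ ;; Ξ' ⊢ EqTerm b b' B ->
    T ▷ Δ ;; Ξ' ++ Ξ
      ⊢ EqTerm (TensorI (lwk_tm (size Ξ') a) b)
               (TensorI (lwk_tm (size Ξ') a') b') (Tensor A B)
| tensor_elim Δ Ξ Ξ' t A B c C :
    enabled T TensorF ->
    T ▷ Δ ;; Ξ ⊢ HasType t (Tensor A B) ->
    T ▷ Δ ;; B :: A :: Ξ' ⊢ HasType c C ->
    T ▷ Δ ;; Ξ' ++ Ξ ⊢ HasType (TensorE (lwk_tm (size Ξ') t) c) C
| tensor_elim_eq Δ Ξ Ξ' t t' A B c c' C :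
    enabled T TensorF ->
    T ▷ Δ ;; Ξ ⊢ EqTerm t t' (Tensor A B) ->
    T ▷ Δ ;; B :: A :: Ξ' ⊢ EqTerm c c' C ->
    T ▷ Δ ;; Ξ' ++ Ξ
      ⊢ EqTerm (TensorE (lwk_tm (size Ξ') t) c)
               (TensorE (lwk_tm (size Ξ') t') c') C
| tensor_beta Δ Ξ1 Ξ2 Ξ' a A b B c C :
    enabled T TensorF ->
    T ▷ Δ ;; Ξ1 ⊢ HasType a A -> T ▷ Δ ;; Ξ2 ⊢ HasType b B ->
    T ▷ Δ ;; B :: A :: Ξ' ⊢ HasType c C ->
    T ▷ Δ ;; Ξ' ++ (Ξ2 ++ Ξ1)
      ⊢ EqTerm
          (TensorE (lwk_tm (size Ξ') (TensorI (lwk_tm (size Ξ2) a) b)) c)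
          (subst_tm IVar
             (scons (lwk_tm (size Ξ') b)
                (scons (lwk_tm (size Ξ' + size Ξ2) a) LVar)) c) C
| tensor_eta Δ Ξ t A B :
    enabled T TensorF ->
    T ▷ Δ ;; Ξ ⊢ HasType t (Tensor A B) ->
    T ▷ Δ ;; Ξ
      ⊢ EqTerm (TensorE t (TensorI (LVar 1) (LVar 0))) t (Tensor A B)
| comm_tensor Δ Ξ Ξ' Ξ'' t A B b D c C
    (k := size (Ξ' ++ Ξ)) (t' := lwk_tm (size Ξ') t) :
    enabled T TensorF ->
    T ▷ Δ ;; Ξ ⊢ HasType t (Tensor A B) ->
    T ▷ Δ ;; B :: A :: Ξ' ⊢ HasType b D ->
    T ▷ Δ ;; D :: Ξ'' ⊢ HasType c C ->
    T ▷ Δ ;; (Ξ' ++ Ξ) ++ Ξ''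
      ⊢ EqTerm (TensorE t' (linst k.+2 b c)) (linst k (TensorE t' b) c) C

(** ⊸ *)
| lolli_form Δ A B :
    enabled T LolliF ->
    T ▷ Δ ;; [::] ⊢ IsType A -> T ▷ Δ ;; [::] ⊢ IsType B ->
    T ▷ Δ ;; [::] ⊢ IsType (Lolli A B)
| lolli_form_eq Δ A A' B B' :
    enabled T LolliF ->
    T ▷ Δ ;; [::] ⊢ EqType A A' -> T ▷ Δ ;; [::] ⊢ EqType B B' ->
    T ▷ Δ ;; [::] ⊢ EqType (Lolli A B) (Lolli A' B')
| lolli_intro Δ Ξ A b B :
    enabled T LolliF ->
    T ▷ Δ ;; A :: Ξ ⊢ HasType b B ->
    T ▷ Δ ;; Ξ ⊢ HasType (LolliI A b) (Lolli A B)
| lolli_intro_eq Δ Ξ A A' b b' B :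
    enabled T LolliF ->
    T ▷ Δ ;; [::] ⊢ EqType A A' -> T ▷ Δ ;; A :: Ξ ⊢ EqTerm b b' B ->
    T ▷ Δ ;; Ξ ⊢ EqTerm (LolliI A b) (LolliI A' b') (Lolli A B)
| lolli_elim Δ Ξ Ξ' f a A B :
    enabled T LolliF ->
    T ▷ Δ ;; Ξ ⊢ HasType f (Lolli A B) -> T ▷ Δ ;; Ξ' ⊢ HasType a A ->
    T ▷ Δ ;; Ξ' ++ Ξ ⊢ HasType (LolliE (lwk_tm (size Ξ') f) a) B
| lolli_elim_eq Δ Ξ Ξ' f f' a a' A B :
    enabled T LolliF ->
    T ▷ Δ ;; Ξ ⊢ EqTerm f f' (Lolli A B) -> T ▷ Δ ;; Ξ' ⊢ EqTerm a a' A ->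
    T ▷ Δ ;; Ξ' ++ Ξ
      ⊢ EqTerm (LolliE (lwk_tm (size Ξ') f) a)
               (LolliE (lwk_tm (size Ξ') f') a') B
| lolli_beta Δ Ξ Ξ' A b B a :
    enabled T LolliF ->
    T ▷ Δ ;; A :: Ξ ⊢ HasType b B -> T ▷ Δ ;; Ξ' ⊢ HasType a A ->
    T ▷ Δ ;; Ξ' ++ Ξ
      ⊢ EqTerm (LolliE (lwk_tm (size Ξ') (LolliI A b)) a)
               (linst (size Ξ') a b) B
| lolli_eta Δ Ξ f A B :
    enabled T LolliF ->
    T ▷ Δ ;; Ξ ⊢ HasType f (Lolli A B) ->
    T ▷ Δ ;; Ξ
      ⊢ EqTerm f (LolliI A (LolliE (lwk_tm 1 f) (LVar 0))) (Lolli A B)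

(** Σ *)
| sigma_form Δ A B :
    enabled T SigmaF ->
    T ▷ A :: Δ ;; [::] ⊢ IsType B -> T ▷ Δ ;; [::] ⊢ IsType (Sigma A B)
| sigma_form_eq Δ A A' B B' :
    enabled T SigmaF ->
    T ▷ Δ ;; [::] ⊢ EqType A A' -> T ▷ A :: Δ ;; [::] ⊢ EqType B B' ->
    T ▷ Δ ;; [::] ⊢ EqType (Sigma A B) (Sigma A' B')
| sigma_intro Δ Ξ a A b B :
    enabled T SigmaF ->
    T ▷ A :: Δ ;; [::] ⊢ IsType B ->
    T ▷ Δ ;; [::] ⊢ HasType a A -> T ▷ Δ ;; Ξ ⊢ HasType b (inst_ty a B) ->
    T ▷ Δ ;; Ξ ⊢ HasType (SigmaI a b) (Sigma A B)
| sigma_intro_eq Δ Ξ a a' A b b' B :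
    enabled T SigmaF ->
    T ▷ A :: Δ ;; [::] ⊢ IsType B ->
    T ▷ Δ ;; [::] ⊢ EqTerm a a' A ->
    T ▷ Δ ;; Ξ ⊢ EqTerm b b' (inst_ty a B) ->
    T ▷ Δ ;; Ξ ⊢ EqTerm (SigmaI a b) (SigmaI a' b') (Sigma A B)
| sigma_elim Δ Ξ Ξ' t A B c C :
    enabled T SigmaF ->
    T ▷ Δ ;; Ξ' ⊢ Ctxt -> T ▷ Δ ;; [::] ⊢ IsType C ->
    T ▷ Δ ;; Ξ ⊢ HasType t (Sigma A B) ->
    T ▷ A :: Δ ;; B :: map wk_ty Ξ' ⊢ HasType c (wk_ty C) ->
    T ▷ Δ ;; Ξ' ++ Ξ ⊢ HasType (SigmaE (lwk_tm (size Ξ') t) c) C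
| sigma_elim_eq Δ Ξ Ξ' t t' A B c c' C :
    enabled T SigmaF ->
    T ▷ Δ ;; Ξ' ⊢ Ctxt -> T ▷ Δ ;; [::] ⊢ IsType C ->
    T ▷ Δ ;; Ξ ⊢ EqTerm t t' (Sigma A B) ->
    T ▷ A :: Δ ;; B :: map wk_ty Ξ' ⊢ EqTerm c c' (wk_ty C) ->
    T ▷ Δ ;; Ξ' ++ Ξ
      ⊢ EqTerm (SigmaE (lwk_tm (size Ξ') t) c)
               (SigmaE (lwk_tm (size Ξ') t') c') C
| sigma_beta Δ Ξ Ξ' a A b B c C :
    enabled T SigmaF ->
    T ▷ Δ ;; Ξ' ⊢ Ctxt -> T ▷ Δ ;; [::] ⊢ IsType C ->
    T ▷ Δ ;; [::] ⊢ HasType a A -> T ▷ Δ ;; Ξ ⊢ HasType b (inst_ty a B) ->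
    T ▷ A :: Δ ;; B :: map wk_ty Ξ' ⊢ HasType c (wk_ty C) ->
    T ▷ Δ ;; Ξ' ++ Ξ
      ⊢ EqTerm (SigmaE (lwk_tm (size Ξ') (SigmaI a b)) c)
               (subst_tm (scons a IVar) (scons (lwk_tm (size Ξ') b) LVar) c) C
| sigma_eta Δ Ξ t A B :
    enabled T SigmaF ->
    T ▷ Δ ;; Ξ ⊢ HasType t (Sigma A B) ->
    T ▷ Δ ;; Ξ ⊢ EqTerm (SigmaE t (SigmaI (IVar 0) (LVar 0))) t (Sigma A B)
| comm_sigma Δ Ξ Ξ' Ξ'' t A B b D c C
    (k := size (Ξ' ++ Ξ)) (t' := lwk_tm (size Ξ') t) :
    enabled T SigmaF ->
    T ▷ Δ ;; Ξ' ⊢ Ctxt -> T ▷ Δ ;; [::] ⊢ IsType D ->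
    T ▷ Δ ;; Ξ ⊢ HasType t (Sigma A B) ->
    T ▷ A :: Δ ;; B :: map wk_ty Ξ' ⊢ HasType b (wk_ty D) ->
    T ▷ Δ ;; D :: Ξ'' ⊢ HasType c C ->
    T ▷ Δ ;; (Ξ' ++ Ξ) ++ Ξ''
      ⊢ EqTerm (SigmaE t' (linst k.+1 b (wk_tm c))) (linst k (SigmaE t' b) c) C

(** Π *)
| pi_form Δ A B :
    enabled T PiF ->
    T ▷ A :: Δ ;; [::] ⊢ IsType B -> T ▷ Δ ;; [::] ⊢ IsType (Pi A B)
| pi_form_eq Δ A A' B B' :
    enabled T PiF ->
    T ▷ Δ ;; [::] ⊢ EqType A A' -> T ▷ A :: Δ ;; [::] ⊢ EqType B B' ->
    T ▷ Δ ;; [::] ⊢ EqType (Pi A B) (Pi A' B')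
| pi_intro Δ Ξ A b B :
    enabled T PiF ->
    T ▷ Δ ;; Ξ ⊢ Ctxt ->
    T ▷ A :: Δ ;; map wk_ty Ξ ⊢ HasType b B ->
    T ▷ Δ ;; Ξ ⊢ HasType (PiI A b) (Pi A B)
| pi_intro_eq Δ Ξ A A' b b' B :
    enabled T PiF ->
    T ▷ Δ ;; Ξ ⊢ Ctxt ->
    T ▷ Δ ;; [::] ⊢ EqType A A' ->
    T ▷ A :: Δ ;; map wk_ty Ξ ⊢ EqTerm b b' B ->
    T ▷ Δ ;; Ξ ⊢ EqTerm (PiI A b) (PiI A' b') (Pi A B)
| pi_elim Δ Ξ f a A B :
    enabled T PiF ->
    T ▷ Δ ;; [::] ⊢ HasType a A -> T ▷ Δ ;; Ξ ⊢ HasType f (Pi A B) ->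
    T ▷ Δ ;; Ξ ⊢ HasType (PiE f a) (inst_ty a B)
| pi_elim_eq Δ Ξ f f' a a' A B :
    enabled T PiF ->
    T ▷ Δ ;; [::] ⊢ EqTerm a a' A -> T ▷ Δ ;; Ξ ⊢ EqTerm f f' (Pi A B) ->
    T ▷ Δ ;; Ξ ⊢ EqTerm (PiE f a) (PiE f' a') (inst_ty a B)
| pi_beta Δ Ξ A b B a :
    enabled T PiF ->
    T ▷ Δ ;; Ξ ⊢ Ctxt ->
    T ▷ A :: Δ ;; map wk_ty Ξ ⊢ HasType b B ->
    T ▷ Δ ;; [::] ⊢ HasType a A ->
    T ▷ Δ ;; Ξ ⊢ EqTerm (PiE (PiI A b) a) (inst_tm a b) (inst_ty a B)
| pi_eta Δ Ξ f A B :
    enabled T PiF ->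
    T ▷ Δ ;; Ξ ⊢ HasType f (Pi A B) ->
    T ▷ Δ ;; Ξ ⊢ EqTerm f (PiI A (PiE (wk_tm f) (IVar 0))) (Pi A B)

where "T ▷ Δ ;; Ξ ⊢ J" := (derives T Δ Ξ J)

with ctxt_eq (S : signature) (T : theory S) :
    ictx S -> lctx S -> ictx S -> lctx S -> Prop :=
| eqctxt_refl Δ Ξ : T ▷ Δ ;; Ξ ⊢ Ctxt -> T ▷ Δ ;; Ξ ≡ Δ ;; Ξ
| eqctxt_sym Δ Ξ Δ' Ξ' : T ▷ Δ ;; Ξ ≡ Δ' ;; Ξ' -> T ▷ Δ' ;; Ξ' ≡ Δ ;; Ξ
| eqctxt_trans Δ Ξ Δ' Ξ' Δ'' Ξ'' :
    T ▷ Δ ;; Ξ ≡ Δ' ;; Ξ' -> T ▷ Δ' ;; Ξ' ≡ Δ'' ;; Ξ'' ->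
    T ▷ Δ ;; Ξ ≡ Δ'' ;; Ξ''
| eqctxt_icons Δ Ξ Δ' Ξ' A A' :
    T ▷ Δ ;; Ξ ≡ Δ' ;; Ξ' -> T ▷ Δ ;; [::] ⊢ EqType A A' ->
    T ▷ Δ ;; [::] ⊢ IsType A -> T ▷ Δ' ;; [::] ⊢ IsType A' ->
    T ▷ A :: Δ ;; map wk_ty Ξ ≡ A' :: Δ' ;; map wk_ty Ξ'
| eqctxt_lcons Δ Ξ Δ' Ξ' A A' :
    T ▷ Δ ;; Ξ ≡ Δ' ;; Ξ' -> T ▷ Δ ;; [::] ⊢ EqType A A' ->
    T ▷ Δ ;; [::] ⊢ IsType A -> T ▷ Δ' ;; [::] ⊢ IsType A' ->
    T ▷ Δ ;; A :: Ξ ≡ Δ' ;; A' :: Ξ'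

where "T ▷ Δ ;; Ξ ≡ Δ' ;; Ξ'" := (ctxt_eq T Δ Ξ Δ' Ξ').

(* [linst 1 f g] is g[f/y], in the linear region x:A. *)
Definition isomorphic {S} (T : theory S) (Δ : ictx S) (A B : ty S) : Prop :=
  [/\ T ▷ Δ ;; [::] ⊢ IsType A,
      T ▷ Δ ;; [::] ⊢ IsType B
    & exists f g : tm S,
      [/\ T ▷ Δ ;; [:: A] ⊢ HasType f B,
          T ▷ Δ ;; [:: B] ⊢ HasType g A,
          T ▷ Δ ;; [:: A] ⊢ EqTerm (linst 1 f g) (LVar 0) A
        & T ▷ Δ ;; [:: B] ⊢ EqTerm (linst 1 g f) (LVar 0) B]].

(* Main.v *)
(* With x not free in B, the maps are
     f ↦ λ_{y:!A} let y be !z in f(!z)    and  h ↦ λ_{!z:!A} h(!z)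
   for Π, and
     t ↦ let t be !x ⊗ y in (!x) ⊗ y      and
     p ↦ let p be u ⊗ y in let u be !z in !z ⊗ y
   for Σ.  After pushing the outer term inside the lets by commuting conversions,
   each composite reduces by β under the binders to an η expansion.  In the two
   composites starting from ⊸ and ⊗ this still leaves a [let u be !z in c[!z/u]],
   which is c by one more commuting conversion and η for !.

   The presupposition that A is a type is recovered by induction on derivations:
   every derivable judgement has a well-formed context. *)

Require Import Defs.
From mathcomp Require Import all_boot.

Set Implicit Arguments.
Unset Strict Implicit.
Unset Printing Implicit Defensive.

(** * Induction on types and terms with argument lists *)

Fixpoint All {X : Type} (P : X -> Prop) (s : seq X) : Prop :=
  if s is x :: s' then P x /\ All P s' else True.

Lemma All_impl X (P Q : X -> Prop) s :
  (forall x, P x -> Q x) -> All P s -> All Q s.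
Proof. by move=> PQ; elim: s => //= x s IHs [/PQ ? /IHs]. Qed.

Lemma All_cat X (P : X -> Prop) s t : All P (s ++ t) <-> All P s /\ All P t.
Proof. by elim: s => [|x s IHs] /=; tauto. Qed.

Lemma All_map X Y (f : X -> Y) (P : Y -> Prop) s :
  All (fun x => P (f x)) s -> All P (map f s).
Proof. by elim: s => //= x s IHs [? /IHs]. Qed.

Section TyTmInd.
Variables (S : signature) (P : ty S -> Prop) (Q : tm S -> Prop).
Hypotheses
  (hTCon : forall c s, All Q s -> P (TCon c s))
  (hBang : forall A, P A -> P (Bang A))
  (hTensor : forall A B, P A -> P B -> P (Tensor A B))
  (hLolli : forall A B, P A -> P B -> P (Lolli A B))
  (hSigma : forall A B, P A -> P B -> P (Sigma A B))
  (hPi : forall A B, P A -> P B -> P (Pi A B))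
  (hIVar : forall n, Q (IVar n))
  (hLVar : forall n, Q (LVar n))
  (hCon : forall c s s', All Q s -> All Q s' -> Q (Con c s s'))
  (hBangI : forall a, Q a -> Q (BangI a))
  (hBangE : forall a b, Q a -> Q b -> Q (BangE a b))
  (hTensorI : forall a b, Q a -> Q b -> Q (TensorI a b))
  (hTensorE : forall a b, Q a -> Q b -> Q (TensorE a b))
  (hLolliI : forall A b, P A -> Q b -> Q (LolliI A b))
  (hLolliE : forall a b, Q a -> Q b -> Q (LolliE a b))
  (hSigmaI : forall a b, Q a -> Q b -> Q (SigmaI a b))
  (hSigmaE : forall a b, Q a -> Q b -> Q (SigmaE a b))
  (hPiI : forall A b, P A -> Q b -> Q (PiI A b))
  (hPiE : forall a b, Q a -> Q b -> Q (PiE a b)).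

(** Constants carry lists of terms, so the local [all] lifts the induction hypothesis from single
    terms to a list. It is defined inside each fixpoint so that the guard condition sees calls on
    subterms only. *)
Fixpoint ty_nested_ind (A : ty S) : P A :=
  let fix all (s : seq (tm S)) : All Q s :=
    if s is t :: s' then conj (tm_nested_ind t) (all s') else I in
  match A with
  | TCon c s => hTCon c (all s)
  | Bang A => hBang (ty_nested_ind A)
  | Tensor A B => hTensor (ty_nested_ind A) (ty_nested_ind B)
  | Lolli A B => hLolli (ty_nested_ind A) (ty_nested_ind B)
  | Sigma A B => hSigma (ty_nested_ind A) (ty_nested_ind B)
  | Pi A B => hPi (ty_nested_ind A) (ty_nested_ind B)
  end
with tm_nested_ind (t : tm S) : Q t :=
  let fix all (s : seq (tm S)) : All Q s :=
    if s is t :: s' then conj (tm_nested_ind t) (all s') else I in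
  match t with
  | IVar n => hIVar n
  | LVar n => hLVar n
  | Con c s s' => hCon c (all s) (all s')
  | BangI a => hBangI (tm_nested_ind a)
  | BangE a b => hBangE (tm_nested_ind a) (tm_nested_ind b)
  | TensorI a b => hTensorI (tm_nested_ind a) (tm_nested_ind b)
  | TensorE a b => hTensorE (tm_nested_ind a) (tm_nested_ind b)
  | LolliI A b => hLolliI (ty_nested_ind A) (tm_nested_ind b)
  | LolliE a b => hLolliE (tm_nested_ind a) (tm_nested_ind b)
  | SigmaI a b => hSigmaI (tm_nested_ind a) (tm_nested_ind b)
  | SigmaE a b => hSigmaE (tm_nested_ind a) (tm_nested_ind b)
  | PiI A b => hPiI (ty_nested_ind A) (tm_nested_ind b)
  | PiE a b => hPiE (tm_nested_ind a) (tm_nested_ind b)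
  end.

Lemma ty_tm_ind : (forall A, P A) /\ (forall t, Q t).
Proof. split; [exact: ty_nested_ind | exact: tm_nested_ind]. Qed.

End TyTmInd.

(** * Equations for renamings and substitutions *)

Lemma eq_map_All X Y (f g : X -> Y) s :
  All (fun x => f x = g x) s -> map f s = map g s.
Proof. by elim: s => //= x s IHs [-> /IHs ->]. Qed.

Lemma up_comp r1 r2 r3 :
  (forall n, r1 (r2 n) = r3 n) -> forall n, up r1 (up r2 n) = up r3 n.
Proof. by move=> h [|n] //=; rewrite h. Qed.

(** The composite is given pointwise because [up r1 \o up r2] agrees with [up r3] only pointwise;
    this form passes under binders without function extensionality. *)
Lemma ren_comp S :
  (forall (A : ty S) r1 r2 r3, (forall n, r1 (r2 n) = r3 n) ->
     ren_ty r1 (ren_ty r2 A) = ren_ty r3 A) /\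
  (forall (t : tm S) r1 r2 r3 l1 l2 l3, (forall n, r1 (r2 n) = r3 n) ->
     (forall n, l1 (l2 n) = l3 n) ->
     ren_tm r1 l1 (ren_tm r2 l2 t) = ren_tm r3 l3 t).
Proof.
have mapE (r1 r2 r3 l1 l2 l3 : nat -> nat) (s : seq (tm S)) :
    (forall n, r1 (r2 n) = r3 n) -> (forall n, l1 (l2 n) = l3 n) ->
    All (fun t => forall r1 r2 r3 l1 l2 l3, (forall n, r1 (r2 n) = r3 n) ->
           (forall n, l1 (l2 n) = l3 n) ->
           ren_tm r1 l1 (ren_tm r2 l2 t) = ren_tm r3 l3 t) s ->
    map (ren_tm r1 l1) (map (ren_tm r2 l2) s) = map (ren_tm r3 l3) s.
  move=> hr hl hs; rewrite -map_comp; apply: eq_map_All.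
  by apply: All_impl hs => t; apply.
apply: ty_tm_ind => /=; intros; f_equal; auto using up_comp.
Qed.

(** Only the indices that occur must be fixed. This lets the lemma apply to [succn \o predn], which
    moves 0 and nothing else. *)
Lemma ren_id S :
  (forall (A : ty S) r, (forall n, occurs_ty n A -> r n = n) ->
     ren_ty r A = A) /\
  (forall (t : tm S) r l, (forall n, occurs_tm n t -> r n = n) ->
     (forall n, l n = n) -> ren_tm r l t = t).
Proof.
have mapE (r l : nat -> nat) (s : seq (tm S)) :
    (forall n, has (occurs_tm n) s -> r n = n) -> (forall n, l n = n) ->
    All (fun t => forall r l, (forall n, occurs_tm n t -> r n = n) ->
           (forall n, l n = n) -> ren_tm r l t = t) s ->
    map (ren_tm r l) s = s.
  move=> hr hl; elim: s hr => //= t s IHs hr [ht hs]; congr (_ :: _).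
    by apply: ht => // n hn; apply: hr; rewrite hn.
  by apply: IHs => // n hn; apply: hr; rewrite hn orbT.
(* Under a binder, index 0 is fixed by [up] and index n+1 is the outer index n. *)
have upE (r : nat -> nat) (o : nat -> bool) :
    (forall n, o n.+1 -> r n = n) -> forall n, o n -> up r n = n.
  by move=> h [|n] //= /h ->.
have upE' (r : nat -> nat) : (forall n, r n = n) -> forall n, up r n = n.
  by move=> h [|n] //=; rewrite h.
have orE (o1 o2 : nat -> bool) (r : nat -> nat) :
    (forall n, o1 n || o2 n -> r n = n) ->
    (forall n, o1 n -> r n = n) /\ (forall n, o2 n -> r n = n).
  by move=> h; split=> n hn; apply: h; rewrite hn ?orbT.
apply: ty_tm_ind => /=; intros;
  repeat match goal with
  | h : forall n, is_true (_ || _) -> _ |- _ => case/orE: h => ? ?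
  end; f_equal; auto; match goal with h : _ |- _ => apply: h; auto end;
  by [apply: (upE _ (occurs_ty^~ _)) | apply: (upE _ (occurs_tm^~ _))].
Qed.

(** The types in both isomorphisms are only ever instantiated at variables, so reducing such
    substitutions to renamings replaces a general calculus of substitutions. *)
Lemma subst_ren S :
  (forall (A : ty S) si r, (forall n, si n = IVar (r n)) ->
     subst_ty si A = ren_ty r A) /\
  (forall (t : tm S) si sl r l, (forall n, si n = IVar (r n)) ->
     (forall n, sl n = LVar (l n)) -> subst_tm si sl t = ren_tm r l t).
Proof.
have mapE (si sl : nat -> tm S) (r l : nat -> nat) (s : seq (tm S)) :
    (forall n, si n = IVar (r n)) -> (forall n, sl n = LVar (l n)) ->
    All (fun t => forall si sl r l, (forall n, si n = IVar (r n)) ->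
           (forall n, sl n = LVar (l n)) -> subst_tm si sl t = ren_tm r l t) s ->
    map (subst_tm si sl) s = map (ren_tm r l) s.
  by move=> hr hl hs; apply: eq_map_All; apply: All_impl hs => t; apply.
have iupE (si : nat -> tm S) (r : nat -> nat) :
    (forall n, si n = IVar (r n)) -> forall n, iup si n = IVar (up r n).
  by move=> h [|n] //=; rewrite h.
have lupE (sl : nat -> tm S) (l : nat -> nat) :
    (forall n, sl n = LVar (l n)) -> forall n, lup sl n = LVar (up l n).
  by move=> h [|n] //=; rewrite h.
have wkE (sl : nat -> tm S) (l : nat -> nat) :
    (forall n, sl n = LVar (l n)) -> forall n, wk_tm (sl n) = LVar (l n).
  by move=> h n; rewrite h.
have lwkE k (si : nat -> tm S) (r : nat -> nat) :
    (forall n, si n = IVar (r n)) -> forall n, lwk_tm k (si n) = IVar (r n).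
  by move=> h n; rewrite h.
apply: ty_tm_ind => /=; intros; f_equal; auto 7.
Qed.

Lemma wk_unwk_ty S (B : ty S) : ~~ occurs_ty 0 B -> wk_ty (unwk_ty B) = B.
Proof.
move=> hB; rewrite /wk_ty /unwk_ty ((ren_comp S).1 _ _ _ (succn \o predn)) //.
by apply: (ren_id S).1 => -[|n] //= h0; rewrite h0 in hB.
Qed.

Lemma wk_ty_up S (B : ty S) : ren_ty (up succn) (wk_ty B) = wk_ty (wk_ty B).
Proof. by rewrite /wk_ty !((ren_comp S).1 _ _ _ (succn \o succn)). Qed.

(** The instantiation is the renaming that sends 0 to n and k+1 to k. After [succn] only the second
    clause is reached, and the composite is the identity. *)
Lemma inst_wk_ty S (n : nat) (B : ty S) :
  inst_ty (IVar n) (wk_ty B) = B.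
Proof.
rewrite /inst_ty ((subst_ren S).1 _ _ (fun m => if m is k.+1 then k else n)).
  rewrite /wk_ty ((ren_comp S).1 _ _ _ id) //; exact: (ren_id S).1.
by case.
Qed.

Lemma subst_ty_IVar S (A : ty S) : subst_ty IVar A = A.
Proof. by rewrite ((subst_ren S).1 _ _ id) //; apply: (ren_id S).1. Qed.

Lemma ren_ty_id S (A : ty S) : ren_ty id A = A.
Proof. exact: (ren_id S).1. Qed.

(* Well-formed contexts of derivable judgements *)
Scheme derives_mut := Minimality for derives Sort Prop
  with ctxt_eq_mut := Minimality for ctxt_eq Sort Prop.

Combined Scheme derives_ctxt_eq_ind from derives_mut, ctxt_eq_mut.

Section Wf.
Variables (S : signature) (T : theory S).

(** A derivation of [Ctxt] may end in a structural or conversion rule and so resists inversion. In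
    this entrywise form the entries are obtained by projection. *)
Fixpoint wf_ictx (Δ : ictx S) : Prop :=
  if Δ is A :: Δ' then T ▷ Δ' ;; [::] ⊢ IsType A /\ wf_ictx Δ' else True.

Definition wf_lctx (Δ : ictx S) : lctx S -> Prop :=
  All (fun A => T ▷ Δ ;; [::] ⊢ IsType A).

Definition wf_ctx Δ Ξ := wf_ictx Δ /\ wf_lctx Δ Ξ.

Lemma wf_ictx_weak Δ' Δ A :
  T ▷ Δ ;; [::] ⊢ IsType A -> wf_ictx (Δ' ++ Δ) ->
  wf_ictx (ren_tel succn Δ' ++ A :: Δ).
Proof.
move=> hA; elim: Δ' => //= B Δ' IH [hB /IH ?]; split=> //.
exact: iweak hB hA.
Qed.

(** The context only records that [wk_ty B] is a type over [A :: Δ]; [hB] is what makes [B :: Δ]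
    well formed, and weakening then moves A over it. *)
Lemma wf_ictx_exch Δ' Δ A B :
  T ▷ Δ ;; [::] ⊢ IsType B -> wf_ictx (Δ' ++ wk_ty B :: A :: Δ) ->
  wf_ictx (ren_tel swap01 Δ' ++ wk_ty A :: B :: Δ).
Proof.
move=> hB; elim: Δ' => /= [[_ [hA hΔ]]|C Δ' IH [hC /IH ?]]; last first.
  by split=> //; exact: iexch hC hB.
by split=> //; exact: (@iweak _ _ _ [::] _ _ _ hA hB).
Qed.

Lemma wf_ictx_subst Δ' Δ A a :
  T ▷ Δ ;; [::] ⊢ HasType a A -> wf_ictx (Δ' ++ A :: Δ) ->
  wf_ictx (subst_tel (scons a IVar) Δ' ++ Δ).
Proof.
move=> ha; elim: Δ' => /= [[]|C Δ' IH [hC /IH ?]] //; split=> //.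
exact: isubst hC ha.
Qed.

Lemma wf_lctx_weak Δ' Δ A Ξ :
  T ▷ Δ ;; [::] ⊢ IsType A -> wf_lctx (Δ' ++ Δ) Ξ ->
  wf_lctx (ren_tel succn Δ' ++ A :: Δ)
          (map (ren_ty (iter (size Δ') up succn)) Ξ).
Proof.
by move=> hA h; apply: All_map; apply: All_impl h => B hB; exact: iweak hB hA.
Qed.

Lemma wf_lctx_exch Δ' Δ A B Ξ :
  T ▷ Δ ;; [::] ⊢ IsType B -> wf_lctx (Δ' ++ wk_ty B :: A :: Δ) Ξ ->
  wf_lctx (ren_tel swap01 Δ' ++ wk_ty A :: B :: Δ)
          (map (ren_ty (iter (size Δ') up swap01)) Ξ).
Proof.
by move=> hB h; apply: All_map; apply: All_impl h => C hC; exact: iexch hC hB.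
Qed.

Lemma wf_lctx_subst Δ' Δ A a Ξ :
  T ▷ Δ ;; [::] ⊢ HasType a A -> wf_lctx (Δ' ++ A :: Δ) Ξ ->
  wf_lctx (subst_tel (scons a IVar) Δ' ++ Δ)
          (map (subst_ty (iter (size Δ') iup (scons a IVar))) Ξ).
Proof.
by move=> ha h; apply: All_map; apply: All_impl h => C hC; exact: isubst hC ha.
Qed.

Lemma wf_lctx_wk Δ Ξ A :
  T ▷ Δ ;; [::] ⊢ IsType A -> wf_lctx Δ Ξ -> wf_lctx (A :: Δ) (map wk_ty Ξ).
Proof. exact: (wf_lctx_weak (Δ' := [::])). Qed.

Lemma wf_lctx_cat Δ Ξ Ξ' :
  wf_lctx Δ (Ξ ++ Ξ') <-> wf_lctx Δ Ξ /\ wf_lctx Δ Ξ'.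
Proof. exact: All_cat. Qed.

(** The induction is simultaneous because [conv_ctxt] refers to context equality. In the other rules
    the regions of the conclusion come from those of the premises: where a premise has only
    [map wk_ty Ξ], an explicit [Ctxt] premise gives Ξ itself, and the structural rules are handled
    by the lemmas above. *)
Lemma derives_wf_ctx :
  (forall Δ Ξ J, T ▷ Δ ;; Ξ ⊢ J -> wf_ctx Δ Ξ) /\
  (forall Δ Ξ Δ' Ξ', T ▷ Δ ;; Ξ ≡ Δ' ;; Ξ' -> wf_ctx Δ Ξ /\ wf_ctx Δ' Ξ').
Proof.
apply: derives_ctxt_eq_ind; intros; subst;
  repeat match goal with
  | h : _ /\ _ |- _ => destruct h
  | h : wf_ctx _ _ |- _ => destruct h
  | h : wf_lctx _ (_ ++ _) |- _ => apply wf_lctx_cat in h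
  | h : wf_lctx _ (_ :: _) |- _ => destruct h
  | h : wf_ictx (_ :: _) |- _ => destruct h
  | h : All (fun A => derives T ?Δ [::] (IsType A)) ?Ξ |- _ =>
      change (wf_lctx Δ Ξ) in h
  | |- _ /\ _ => split
  | |- wf_ctx _ _ => split
  | |- wf_lctx _ (_ ++ _) => apply/wf_lctx_cat
  | |- wf_lctx _ (_ :: _) => split
  end; try done;
  eauto using wf_ictx_weak, wf_ictx_exch, wf_ictx_subst, wf_lctx_weak,
    wf_lctx_exch, wf_lctx_subst, wf_lctx_wk.
Qed.

Lemma wf_ictx_ctxt Δ : wf_ictx Δ -> T ▷ Δ ;; [::] ⊢ Ctxt.
Proof.
elim: Δ => [_|A Δ IH [hA /IH hΔ]]; first exact: ctxt_nil.
exact: (ctxt_icons hΔ hA).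
Qed.

Lemma type_ctxt Δ J : T ▷ Δ ;; [::] ⊢ J -> T ▷ Δ ;; [::] ⊢ Ctxt.
Proof. by case/derives_wf_ctx.1 => /wf_ictx_ctxt. Qed.

Lemma type_lctxt Δ C : T ▷ Δ ;; [::] ⊢ IsType C -> T ▷ Δ ;; [:: C] ⊢ Ctxt.
Proof. by move=> hC; apply: (ctxt_lcons _ hC); apply: type_ctxt hC. Qed.

Lemma lvar0 Δ C :
  T ▷ Δ ;; [::] ⊢ IsType C -> T ▷ Δ ;; [:: C] ⊢ HasType (LVar 0) C.
Proof. by move=> hC; apply/lvar/type_lctxt. Qed.

Lemma wk_type Δ A C :
  T ▷ Δ ;; [::] ⊢ IsType A -> T ▷ Δ ;; [::] ⊢ IsType C ->
  T ▷ A :: Δ ;; [::] ⊢ IsType (wk_ty C).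
Proof. by move=> hA hC; exact: (iweak (Δ' := [::]) hC hA). Qed.

Lemma ivar0 Δ A :
  T ▷ Δ ;; [::] ⊢ IsType A -> T ▷ A :: Δ ;; [::] ⊢ HasType (IVar 0) (wk_ty A).
Proof.
move=> hA; apply: (@ivar _ _ _ [::]) => /=; exact: (type_ctxt (wk_type hA hA)).
Qed.

End Wf.

(** The weakening of a non-dependent Π is again one. Hence typing lemmas instantiated at the
    weakened types can be used under an intuitionistic binder. *)
Lemma wk_Pi S (A B : ty S) :
  wk_ty (Pi A (wk_ty B)) = Pi (wk_ty A) (wk_ty (wk_ty B)).
Proof. by rewrite -wk_ty_up. Qed.

Lemma wk_Sigma S (A B : ty S) :
  wk_ty (Sigma A (wk_ty B)) = Sigma (wk_ty A) (wk_ty (wk_ty B)).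
Proof. by rewrite -wk_ty_up. Qed.

(** * Expansion along a variable of type !A *)

Section Bang.
Variables (S : signature) (T : theory S) (hbang : enabled T BangF).
Variables (Δ : ictx S) (A : ty S).
Hypothesis hA : T ▷ Δ ;; [::] ⊢ IsType A.

Lemma bang_type : T ▷ Δ ;; [::] ⊢ IsType (Bang A).
Proof. exact: bang_form. Qed.

Lemma bang_ivar0 :
  T ▷ A :: Δ ;; [::] ⊢ HasType (BangI (IVar 0)) (wk_ty (Bang A)).
Proof. by apply: bang_intro => //; exact: ivar0. Qed.

(* Commuting conversion with [let y be !z in !z], then η for !. *)
Lemma bang_expand Ξ c C :
  T ▷ Δ ;; Bang A :: Ξ ⊢ HasType c C ->
  T ▷ Δ ;; Bang A :: Ξ
    ⊢ EqTerm (BangE (LVar 0) (linst 1 (BangI (IVar 0)) (wk_tm c)))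
             (linst 1 (LVar 0) c) C.
Proof.
move=> hc; have hy := lvar0 bang_type.
have h := comm_bang (Ξ' := [::]) hbang (type_ctxt hA) bang_type hy bang_ivar0 hc.
apply: eqtm_trans h _.
exact: (lsubst_eqtm (eqtm_refl hc) (bang_eta hbang hy)).
Qed.

End Bang.

(** * The isomorphism between Π_{!x:!A} B and !A ⊸ B *)

(** Below [LolliI] the argument has linear index 0 and f has index 1. [BangE] binds no linear
    variable, so f keeps index 1 in its body. *)
Definition pi_to_lolli S (A : ty S) : tm S :=
  LolliI (Bang A) (BangE (LVar 0) (PiE (LVar 1) (IVar 0))).

Definition lolli_to_pi S (A : ty S) : tm S :=
  PiI A (LolliE (LVar 0) (BangI (IVar 0))).

Section PiLolli.
Variables (S : signature) (T : theory S) (hbang : enabled T BangF).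
Variables (hpi : enabled T PiF) (hlolli : enabled T LolliF).

Section Typing.
Variables (Δ : ictx S) (A B : ty S).
Hypotheses (hA : T ▷ Δ ;; [::] ⊢ IsType A) (hB : T ▷ Δ ;; [::] ⊢ IsType B).

Lemma pi_type : T ▷ Δ ;; [::] ⊢ IsType (Pi A (wk_ty B)).
Proof. by apply: pi_form => //; exact: wk_type. Qed.

Lemma lolli_type : T ▷ Δ ;; [::] ⊢ IsType (Lolli (Bang A) B).
Proof. by apply: lolli_form => //; exact: bang_type. Qed.

Lemma pi_ivar0 :
  T ▷ A :: Δ ;; [:: wk_ty (Pi A (wk_ty B))]
    ⊢ HasType (PiE (LVar 0) (IVar 0)) (wk_ty B).
Proof.
have := lvar0 (wk_type hA pi_type); rewrite wk_Pi => hf.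
(* The second occurrence is the type of the application. It is turned into an instance at [IVar 0],
   the form that Π-elimination produces. *)
by rewrite -{2}(inst_wk_ty 0 (wk_ty B)); apply: pi_elim (ivar0 hA) hf.
Qed.

Lemma pi_to_lolli_body :
  T ▷ Δ ;; [:: Bang A; Pi A (wk_ty B)]
    ⊢ HasType (BangE (LVar 0) (PiE (LVar 1) (IVar 0))) B.
Proof.
have h := bang_elim (Ξ' := [:: _]) hbang (type_lctxt pi_type) hB
            (lvar0 (bang_type hbang hA)) pi_ivar0.
(* Elimination puts the region of the scrutinee last; exchange brings !A to the head, where λ can
   abstract it. *)
rewrite -{2}(ren_ty_id B); exact: (lexch (Ξ' := [::]) (Ξ := [::]) h).
Qed.

Lemma pi_to_lolli_type :
  T ▷ Δ ;; [:: Pi A (wk_ty B)]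
    ⊢ HasType (pi_to_lolli A) (Lolli (Bang A) B).
Proof. by apply: lolli_intro => //; exact: pi_to_lolli_body. Qed.

Lemma lolli_bang_ivar0 :
  T ▷ A :: Δ ;; [:: wk_ty (Lolli (Bang A) B)]
    ⊢ HasType (LolliE (LVar 0) (BangI (IVar 0))) (wk_ty B).
Proof.
exact: (lolli_elim (Ξ' := [::]) hlolli (lvar0 (wk_type hA lolli_type))
          (bang_ivar0 hbang hA)).
Qed.

Lemma lolli_to_pi_type :
  T ▷ Δ ;; [:: Lolli (Bang A) B]
    ⊢ HasType (lolli_to_pi A) (Pi A (wk_ty B)).
Proof.
apply: pi_intro => //; first exact: (type_lctxt lolli_type).
exact: lolli_bang_ivar0.
Qed.

Lemma lolli_lvar0 :
  T ▷ Δ ;; [:: Bang A; Lolli (Bang A) B]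
    ⊢ HasType (LolliE (LVar 1) (LVar 0)) B.
Proof.
exact: (lolli_elim (Ξ' := [:: _]) hlolli (lvar0 lolli_type)
          (lvar0 (bang_type hbang hA))).
Qed.

End Typing.

Variables (Δ : ictx S) (A B : ty S).
Hypotheses (hA : T ▷ Δ ;; [::] ⊢ IsType A) (hB : T ▷ Δ ;; [::] ⊢ IsType B).

(** With the right side η-expanded, the bodies over [A :: Δ] are compared: (λ_{y:!A} let y be !z in
    f(!z))(!x) becomes let !x be !z in f(!z), and then f(!x). *)
Lemma pi_to_lolliK :
  T ▷ Δ ;; [:: Pi A (wk_ty B)]
    ⊢ EqTerm (linst 1 (pi_to_lolli A) (lolli_to_pi A)) (LVar 0)
             (Pi A (wk_ty B)).
Proof.
have hwA := wk_type hA hA; have hwB := wk_type hA hB.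
rewrite /linst /= subst_ty_IVar.
apply: eqtm_trans (eqtm_sym (pi_eta hpi (lvar0 (pi_type hA hB)))).
apply: pi_intro_eq (eqty_refl hA) _ => //; first exact/type_lctxt/pi_type.
have hbody := pi_to_lolli_body hwA hwB; rewrite -wk_Pi in hbody.
have hpiE := pi_ivar0 hwA hwB; rewrite -wk_Pi in hpiE.
have hbeta := lolli_beta (Ξ' := [::]) hlolli hbody (bang_ivar0 hbang hA).
(* Weakening by the empty region leaves a [ren_ty id] on the annotation of the λ. *)
rewrite /lwk_tm /= ren_ty_id in hbeta; apply: eqtm_trans hbeta _.
exact: (bang_beta (Ξ' := [:: _]) hbang (type_lctxt (wk_type hA (pi_type hA hB)))
          hwB (ivar0 hA) hpiE).
Qed.

Lemma lolli_to_piK :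
  T ▷ Δ ;; [:: Lolli (Bang A) B]
    ⊢ EqTerm (linst 1 (lolli_to_pi A) (pi_to_lolli A)) (LVar 0)
             (Lolli (Bang A) B).
Proof.
have hF := lolli_type hA hB; have hbA := bang_type hbang hA.
rewrite /linst /= !subst_ty_IVar.
apply: eqtm_trans (eqtm_sym (lolli_eta hlolli (lvar0 hF))).
apply: lolli_intro_eq (eqty_refl hbA) _ => //.
(* The right side h(y) is replaced by let y be !z in h(!z), so that only β for Π under the let
   remains. *)
apply: eqtm_trans (bang_expand hbang hA (lolli_lvar0 hA hB)).
have hwA := wk_type hA hA; have hwB := wk_type hA hB.
have hbeta := pi_beta hpi (type_lctxt (lolli_type hwA hwB))
                (lolli_bang_ivar0 hwA hwB) (ivar0 hA).
rewrite inst_wk_ty in hbeta.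
have h := bang_elim_eq (Ξ' := [:: _]) hbang (type_lctxt hF) hB
            (eqtm_refl (lvar0 hbA)) hbeta.
have := lexch (Ξ' := [::]) (Ξ := [::]) h.
(* The exchange passes under [BangE] as [up id], which is the identity only pointwise. *)
have upE : ren_ty (up id) (wk_ty A) = wk_ty A by apply: (ren_id S).1; case.
by rewrite /wk_tm /lwk_tm /= upE !ren_ty_id.
Qed.
End PiLolli.

(** * The isomorphism between Σ_{!x:!A} B and !A ⊗ B *)

Definition sigma_to_tensor S : tm S :=
  SigmaE (LVar 0) (TensorI (BangI (IVar 0)) (LVar 0)).

Definition tensor_to_sigma S : tm S :=
  TensorE (LVar 0) (BangE (LVar 1) (SigmaI (IVar 0) (LVar 0))).

Section SigmaTensor.
Variables (S : signature) (T : theory S) (hbang : enabled T BangF).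
Variables (hsigma : enabled T SigmaF) (htensor : enabled T TensorF).

Section Typing.
Variables (Δ : ictx S) (A B : ty S).
Hypotheses (hA : T ▷ Δ ;; [::] ⊢ IsType A) (hB : T ▷ Δ ;; [::] ⊢ IsType B).

Lemma sigma_type : T ▷ Δ ;; [::] ⊢ IsType (Sigma A (wk_ty B)).
Proof. by apply: sigma_form => //; exact: wk_type. Qed.

Lemma tensor_type : T ▷ Δ ;; [::] ⊢ IsType (Tensor (Bang A) B).
Proof. by apply: tensor_form => //; exact: bang_type. Qed.

Lemma tensor_ivar0 :
  T ▷ A :: Δ ;; [:: wk_ty B]
    ⊢ HasType (TensorI (BangI (IVar 0)) (LVar 0)) (wk_ty (Tensor (Bang A) B)).
Proof.
exact: (tensor_intro (Ξ := [::]) (Ξ' := [:: _]) htensor (bang_ivar0 hbang hA)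
          (lvar0 (wk_type hA hB))).
Qed.

Lemma sigma_to_tensor_type :
  T ▷ Δ ;; [:: Sigma A (wk_ty B)]
    ⊢ HasType (sigma_to_tensor S) (Tensor (Bang A) B).
Proof.
exact: (sigma_elim (Ξ' := [::]) hsigma (type_ctxt hA) tensor_type
          (lvar0 sigma_type) tensor_ivar0).
Qed.

Lemma tensor_lvars :
  T ▷ Δ ;; [:: B; Bang A]
    ⊢ HasType (TensorI (LVar 1) (LVar 0)) (Tensor (Bang A) B).
Proof.
exact: (tensor_intro (Ξ' := [:: _]) htensor (lvar0 (bang_type hbang hA))
          (lvar0 hB)).
Qed.

Lemma sigma_ivar0 :
  T ▷ A :: Δ ;; [:: wk_ty B]
    ⊢ HasType (SigmaI (IVar 0) (LVar 0)) (wk_ty (Sigma A (wk_ty B))).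
Proof.
rewrite wk_Sigma; apply: sigma_intro (ivar0 hA) _ => //.
  exact: wk_type (wk_type hA hA) (wk_type hA hB).
by rewrite inst_wk_ty; apply: lvar0; exact: wk_type.
Qed.

Lemma tensor_to_sigma_body :
  T ▷ Δ ;; [:: B; Bang A]
    ⊢ HasType (BangE (LVar 1) (SigmaI (IVar 0) (LVar 0))) (Sigma A (wk_ty B)).
Proof.
exact: (bang_elim (Ξ' := [:: _]) hbang (type_lctxt hB) sigma_type
          (lvar0 (bang_type hbang hA)) sigma_ivar0).
Qed.

Lemma tensor_to_sigma_type :
  T ▷ Δ ;; [:: Tensor (Bang A) B]
    ⊢ HasType (tensor_to_sigma S) (Sigma A (wk_ty B)).
Proof.
exact: (tensor_elim (Ξ' := [::]) htensor (lvar0 tensor_type)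
          tensor_to_sigma_body).
Qed.

End Typing.

Variables (Δ : ictx S) (A B : ty S).
Hypotheses (hA : T ▷ Δ ;; [::] ⊢ IsType A) (hB : T ▷ Δ ;; [::] ⊢ IsType B).
Let hwA := wk_type hA hA.
Let hwB := wk_type hA hB.
Let hbA := bang_type hbang hA.
Let hS := sigma_type hA hB.
Let hT := tensor_type hA hB.

Lemma sigma_to_tensorK :
  T ▷ Δ ;; [:: Sigma A (wk_ty B)]
    ⊢ EqTerm (linst 1 (sigma_to_tensor S) (tensor_to_sigma S)) (LVar 0)
             (Sigma A (wk_ty B)).
Proof.
have hcomm := comm_sigma (Ξ' := [::]) hsigma (type_ctxt hA) hT (lvar0 hS)
                (tensor_ivar0 hA hB) (tensor_to_sigma_type hA hB).
apply: eqtm_trans (eqtm_sym hcomm) _.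
apply: eqtm_trans (sigma_eta hsigma (lvar0 hS)).
have hbody := tensor_to_sigma_body hwA hwB; rewrite -wk_Sigma in hbody.
have hsig := sigma_ivar0 hwA hwB; rewrite -wk_Sigma in hsig.
have htb := tensor_beta (Ξ1 := [::]) (Ξ2 := [:: _]) (Ξ' := [::]) htensor
              (bang_ivar0 hbang hA) (lvar0 hwB) hbody.
have hbb := bang_beta (Ξ' := [:: _]) hbang (type_lctxt hwB) (wk_type hA hS)
              (ivar0 hA) hsig.
(* The contractum of the ⊗-redex is, by computation, the !-redex let !x be !z in !z ⊗ y. *)
have h := eqtm_trans htb hbb.
exact: (sigma_elim_eq (Ξ' := [::]) hsigma (type_ctxt hA) hS
         (eqtm_refl (lvar0 hS)) h).
Qed.

Lemma tensor_to_sigmaK :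
  T ▷ Δ ;; [:: Tensor (Bang A) B]
    ⊢ EqTerm (linst 1 (tensor_to_sigma S) (sigma_to_tensor S)) (LVar 0)
             (Tensor (Bang A) B).
Proof.
have hf := sigma_to_tensor_type hA hB.
have hcomm := comm_tensor (Ξ' := [::]) htensor (lvar0 hT)
                (tensor_to_sigma_body hA hB) hf.
apply: eqtm_trans (eqtm_sym hcomm) _.
apply: eqtm_trans (tensor_eta htensor (lvar0 hT)).
(* The conversion yields [linst 3], while the region here has size 2, the value that [comm_bang]
   produces next. Both compute to the same term since 0 is the only free linear index of
   [sigma_to_tensor]. *)
suff h : T ▷ Δ ;; [:: B; Bang A]
    ⊢ EqTerm (linst 2 (BangE (LVar 1) (SigmaI (IVar 0) (LVar 0)))
                      (sigma_to_tensor S))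
             (TensorI (LVar 1) (LVar 0)) (Tensor (Bang A) B).
  exact: (tensor_elim_eq (Ξ' := [::]) htensor (eqtm_refl (lvar0 hT)) h).
have hcomm' := comm_bang (Ξ' := [:: _]) hbang (type_lctxt hB) hS (lvar0 hbA)
                 (sigma_ivar0 hA hB) hf.
apply: eqtm_trans (eqtm_sym hcomm') _.
have hy : T ▷ A :: Δ ;; [:: wk_ty B]
    ⊢ HasType (LVar 0) (inst_ty (IVar 0) (wk_ty (wk_ty B))).
  by rewrite inst_wk_ty; exact: lvar0.
have hbeta := sigma_beta (Ξ' := [::]) hsigma (type_ctxt hwA) (wk_type hA hT)
                (ivar0 hA) hy (tensor_ivar0 hwA hwB).
apply: eqtm_trans.
  exact: (bang_elim_eq (Ξ' := [:: _]) hbang (type_lctxt hB) hT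
            (eqtm_refl (lvar0 hbA)) hbeta).
(* [bang_expand] needs u:!A at the head of the region, whereas ⊗-elimination puts y there; hence one
   exchange before and one after. *)
have hc := lexch (Ξ' := [::]) (Ξ := [::]) (tensor_lvars hA hB).
have := lexch (Ξ' := [::]) (Ξ := [::]) (bang_expand hbang hA hc).
by rewrite /= !ren_ty_id.
Qed.
End SigmaTensor.

(** * Both isomorphisms for a type in which x is not free *)

Theorem theorem2 (S : signature) (T : theory S) (hbang : enabled T BangF)
    (Δ : seq (ty S)) (A B : ty S)
    (hB : T ▷ A :: Δ ;; [::] ⊢ IsType B)
    (hx : ~~ occurs_ty 0 B)
    (hB' : T ▷ Δ ;; [::] ⊢ IsType (unwk_ty B)) :
  (enabled T PiF -> enabled T LolliF ->
     isomorphic T Δ (Pi A B) (Lolli (Bang A) (unwk_ty B))) /\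
  (enabled T SigmaF -> enabled T TensorF ->
     isomorphic T Δ (Sigma A B) (Tensor (Bang A) (unwk_ty B))).
Proof.
have [[hA _] _] := (derives_wf_ctx T).1 _ _ _ hB.
(* Occurrences 1 and 3 are the bodies of Π and Σ; the other two stand under [unwk_ty] and must
   stay. *)
rewrite -{1 3}(wk_unwk_ty hx).
split=> [hpi hlolli|hsigma htensor]; split.
- exact: pi_type.
- exact: lolli_type.
- exists (pi_to_lolli A), (lolli_to_pi A); split.
  + exact: pi_to_lolli_type.
  + exact: lolli_to_pi_type.
  + exact: pi_to_lolliK.
  + exact: lolli_to_piK.
- exact: sigma_type.
- exact: tensor_type.
- exists (sigma_to_tensor S), (tensor_to_sigma S); split.
  + exact: sigma_to_tensor_type.
  + exact: tensor_to_sigma_type.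
  + exact: sigma_to_tensorK.
  + exact: tensor_to_sigmaK.
Qed.
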